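(* Let $X$ be a permutative LD-system with a unique left-identity $1$. Then (1) there exists a unique binary operation $\circ$ on $X$ such that $(x*y)\circ x=x\circ y$ and $x=x\circ1$ for all $x,y\in X$; (2) the algebra $(X,*,\circ,1)$ is an LD-monoid; and (3) if $(x_1,\dots,x_n),(y_1,\dots,y_n)\in X^n$, $s\in B_n^+$ is an element with $(x_1,\dots,x_n)\cdot s=(y_1,\dots,y_n)$, and $j\in\{1,\dots,n\}$ is such that $y_i=1$ for all $i\ne j$, then $y_j=x_1\circ\dots\circ x_n$.
   Context: An LD-system is a set $X$ with a binary operation $*$ satisfying $x*(y*z)=(x*y)*(x*z)$. A left-identity is an $x\in X$ with $x*y=y$ for all $y\in X$; $\mathrm{Li}(X)$ is the set of left-identities. $X$ is permutative if $\mathrm{Li}(X)$ is a left-ideal ($y\in\mathrm{Li}(X)\Rightarrow x*y\in\mathrm{Li}(X)$ for all $x$) and for all $x,y\in X$ there is $n\ge1$ with $t_n(x,y)\in\mathrm{Li}(X)$, where $t_1(x,y)=y$, $t_2(x,y)=x$, $t_{n+2}(x,y)=t_{n+1}(x,y)*t_n(x,y)$. An LD-monoid is an algebra $(X,*,\circ,1)$ such that $(X,\circ,1)$ is a monoid and the identities $(x\circ y)*z=x*(y*z)$, $x*(y\circ z)=(x*y)\circ(x*z)$, $x\circ y=(x*y)\circ x$, $1*x=x$, $x*1=1$ hold. $B_n^+$ is the positive braid monoid: generators $\sigma_1,\dots,\sigma_{n-1}$, relations $\sigma_i\sigma_j=\sigma_j\sigma_i$ for $|i-j|>1$ and $\sigma_i\sigma_{i+1}\sigma_i=\sigma_{i+1}\sigma_i\sigma_{i+1}$.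 It acts on the right on $X^n$ (Hurwitz action) by $(x_1,\dots,x_n)\sigma_i=(x_1,\dots,x_{i-1},x_i*x_{i+1},x_i,x_{i+2},\dots,x_n)$. (Any two elements $r,s\in B_n^+$ have a common right multiple $rt=su$.) *)

(* Defs.v *)
From HB Require Import structures.
From mathcomp Require Import all_boot.
From mathcomp Require Import boolp.

Set Implicit Arguments.
Unset Strict Implicit.
Unset Printing Implicit Defensive.

HB.mixin Record isLDSystem X := {
  ldop : X -> X -> X;
  ldopD : forall x y z, ldop x (ldop y z) = ldop (ldop x y) (ldop x z)
}.

#[short(type="ldSystemType")]
HB.structure Definition LDSystem := {X of isLDSystem X}.

Declare Scope ld_scope.
Delimit Scope ld_scope with LD.
Local Open Scope ld_scope.

Notation "x * y" := (ldop x y) : ld_scope.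

Section LDSystemNotions.
Variable X : ldSystemType.

Definition Li (x : X) : Prop := forall y, x * y = y.

(* The sequence is indexed from 1; the value at 0 is junk. *)
Fixpoint tseq (x y : X) (n : nat) : X :=
  match n with
  | 0 | 1 => y
  | 2 => x
  | ((m.+1) as k).+1 => tseq x y k * tseq x y m
  end.

Definition permutative : Prop :=
  (forall x y : X, Li y -> Li (x * y)) /\
  (forall x y : X, exists n, 1 <= n /\ Li (tseq x y n)).

Record is_LDMonoid (circ : X -> X -> X) (e : X) : Prop := {
  ldm_circA : associative circ;
  ldm_1circ : left_id e circ;
  ldm_circ1 : right_id e circ;
  ldm_circ_act : forall x y z, circ x y * z = x * (y * z);
  ldm_act_circ : forall x y z, x * circ y z = circ (x * y) (x * z);
  ldm_circ_comm : forall x y, circ x y = circ (x * y) x;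
  ldm_1act : forall x, e * x = x;
  ldm_act1 : forall x, x * e = e
}.

End LDSystemNotions.

Arguments permutative X : clear implicits.

(* Words in the generators of the n-strand positive braid monoid.  Generators,
   strands and entries of n-tuples are all numbered from 0, so the letter
   [i : 'I_n.-1] stands for sigma_(i+1). *)
Definition braid_word n := seq 'I_n.-1.

Inductive braid_equiv n : braid_word n -> braid_word n -> Prop :=
| braid_equiv_refl u : braid_equiv u u
| braid_equiv_sym u v : braid_equiv u v -> braid_equiv v u
| braid_equiv_trans v u w :
    braid_equiv u v -> braid_equiv v w -> braid_equiv u w
| braid_equiv_cat u u' v v' :
    braid_equiv u u' -> braid_equiv v v' -> braid_equiv (u ++ v) (u' ++ v')
| braid_equiv_far (i j : 'I_n.-1) :
    (i.+1 < j) || (j.+1 < i) -> braid_equiv [:: i; j] [:: j; i]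
| braid_equiv_near (i j : 'I_n.-1) :
    j = i.+1 :> nat -> braid_equiv [:: i; j; i] [:: j; i; j].

Definition braid_rel n : rel (braid_word n) := fun u v => `[< braid_equiv u v >].

Lemma braid_rel_refl n : reflexive (@braid_rel n).
Proof. by move=> u; apply/asboolP; exact: braid_equiv_refl. Qed.

Lemma braid_rel_sym n : symmetric (@braid_rel n).
Proof. by move=> u v; apply/asboolP/asboolP; exact: braid_equiv_sym. Qed.

Lemma braid_rel_trans n : transitive (@braid_rel n).
Proof.
move=> v u w /asboolP uv /asboolP vw; apply/asboolP.
exact: braid_equiv_trans uv vw.
Qed.

Canonical braid_equiv_rel n :=
  EquivRel (@braid_rel n) (@braid_rel_refl n) (@braid_rel_sym n)
    (@braid_rel_trans n).

Local Open Scope quotient_scope.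

Definition braid n := {eq_quot (braid_equiv_rel n)}.

HB.instance Definition _ n := Choice.on (braid n).

Lemma braid_piP n (u v : braid_word n) :
  reflect (braid_equiv u v) (\pi_(braid n) u == \pi_(braid n) v).
Proof. by rewrite eqmodE; exact: asboolP. Qed.

Lemma braid_repr_pi n (u : braid_word n) : braid_equiv (repr (\pi_(braid n) u)) u.
Proof. by apply/braid_piP; rewrite reprK. Qed.

Section BraidMonoid.
Variable n : nat.

Definition sigma (i : 'I_n.-1) : braid n := \pi_(braid n) [:: i].
Definition braid_one : braid n := \pi_(braid n) [::].
Definition braid_mul (r s : braid n) : braid n := \pi_(braid n) (repr r ++ repr s).

Lemma braid_mul_pi (u v : braid_word n) :
  braid_mul (\pi_(braid n) u) (\pi_(braid n) v) = \pi_(braid n) (u ++ v).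
Proof.
apply/eqP; apply/braid_piP; apply: braid_equiv_cat; exact: braid_repr_pi.
Qed.

Lemma braid_mulA : associative braid_mul.
Proof.
elim/quotW=> u; elim/quotW=> v; elim/quotW=> w.
by rewrite (braid_mul_pi v w) (braid_mul_pi u v) (braid_mul_pi u) (braid_mul_pi _ w) catA.
Qed.

Lemma braid_mul1 : left_id braid_one braid_mul.
Proof. by elim/quotW=> u; rewrite braid_mul_pi. Qed.

Lemma braid_mulr1 : right_id braid_one braid_mul.
Proof. by elim/quotW=> u; rewrite braid_mul_pi cats0. Qed.

HB.instance Definition _ :=
  isMonoid.Build (braid n) braid_mulA braid_mul1 braid_mulr1.

End BraidMonoid.

Section Hurwitz.
Variables (X : ldSystemType) (n : nat).

Lemma strand_proof (i : 'I_n.-1) : i < n.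
Proof. exact: leq_trans (ltn_ord i) (leq_pred n). Qed.

Lemma strandS_proof (i : 'I_n.-1) : i.+1 < n.
Proof. by rewrite -ltn_predRL. Qed.

Definition strand (i : 'I_n.-1) : 'I_n := Ordinal (strand_proof i).
Definition strandS (i : 'I_n.-1) : 'I_n := Ordinal (strandS_proof i).

Definition hurwitz_gen (x : n.-tuple X) (i : 'I_n.-1) : n.-tuple X :=
  [tuple if k == strand i then tnth x (strand i) * tnth x (strandS i)
         else if k == strandS i then tnth x (strand i)
         else tnth x k | k < n].

Definition hurwitz_word (x : n.-tuple X) (u : braid_word n) : n.-tuple X :=
  foldl hurwitz_gen x u.

(* The choice of word representing the braid is irrelevant: see [hurwitz_pi]. *)
Definition hurwitz (x : n.-tuple X) (s : braid n) : n.-tuple X :=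
  hurwitz_word x (repr s).

Lemma hurwitz_word_equiv (u v : braid_word n) :
  braid_equiv u v -> forall x, hurwitz_word x u = hurwitz_word x v.
Proof.
rewrite /hurwitz_word; elim=> {u v}
  [//|u v _ IH x|v u w _ IH1 _ IH2 x|u u' v v' _ IH1 _ IH2 x|i j ij x|i j ij x].
- by rewrite IH.
- by rewrite IH1.
- by rewrite !foldl_cat IH1 IH2.
- have far (a b : 'I_n.-1) : a.+1 < b ->
      hurwitz_gen (hurwitz_gen x a) b = hurwitz_gen (hurwitz_gen x b) a.
    move=> ltSab; have ltab := ltnW ltSab; have ltabS := ltnW (ltnW ltSab).
    have neqE := (ltn_eqF ltSab, gtn_eqF ltSab, ltn_eqF ltab, gtn_eqF ltab,
      ltn_eqF (ltabS : a < b.+1), gtn_eqF (ltabS : a < b.+1)).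
    apply: eq_from_tnth => k; rewrite /= !tnth_mktuple -!val_eqE /= !eqSS !neqE.
    have [->|_] := eqVneq (k : nat) a; first by rewrite !neqE.
    by have [->|//] := eqVneq (k : nat) a.+1; rewrite ?eqSS !neqE.
  by case/orP: ij => /far /= ->.
- have Ej : strand j = strandS i by apply: val_inj.
  apply: eq_from_tnth => k; rewrite /= !tnth_mktuple Ej -!val_eqE /= ij.
  have neqE := (ltn_eqF (ltnSn i), gtn_eqF (ltnSn i),
    ltn_eqF (leqnSn i.+1), gtn_eqF (leqnSn i.+1),
    ltn_eqF (leqnSn i.+1 : i < i.+2), gtn_eqF (leqnSn i.+1 : i < i.+2)).
  rewrite !eqSS !eqxx !neqE.
  have [->|_] := eqVneq (k : nat) i; first by rewrite !neqE [RHS]ldopD.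
  have [//|_] := eqVneq (k : nat) i.+1.
  by case: ifP.
Qed.

Lemma hurwitz_pi (x : n.-tuple X) (u : braid_word n) :
  hurwitz x (\pi_(braid n) u) = hurwitz_word x u.
Proof. exact: hurwitz_word_equiv (braid_repr_pi u) x. Qed.

Lemma hurwitz_sigma (x : n.-tuple X) (i : 'I_n.-1) :
  hurwitz x (sigma i) = hurwitz_gen x i.
Proof. exact: hurwitz_pi. Qed.

Lemma hurwitz1 (x : n.-tuple X) : hurwitz x 1%g = x.
Proof. exact: hurwitz_pi. Qed.

Lemma hurwitzM (x : n.-tuple X) (r s : braid n) :
  hurwitz x (r * s)%g = hurwitz (hurwitz x r) s.
Proof. by rewrite hurwitz_pi /hurwitz_word foldl_cat. Qed.

End Hurwitz.

(* Main.v *)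
(** Write t_n for the Fibonacci-like sequence of a pair (x, y).  The pair
    (t_{n+1}, t_n) runs through the orbit of (x, y) under sigma_1, so any
    sigma_1-invariant operation with right unit e must send (x, y) to t_{n+1}
    as soon as t_n = e; from then on the orbit alternates between (c, e) and
    (e, c), so this prescription is consistent.

    Associativity compares two ways of moving (x, y, z) by positive braids to
    a triple with a single entry different from e.  Such triples are only
    permuted by further braids, so it is enough that the two braids have a
    common right multiple; a large power of the half twist is one. *)

Require Import Defs.
From HB Require Import structures.
From mathcomp Require Import all_boot.
From mathcomp Require Import boolp.

Local Open Scope ld_scope.

(** * Identities for the sequence t_n *)

Section FibonacciSequence.
Variable X : ldSystemType.
Implicit Types x y z : X.

Lemma tseqSSS x y n : tseq x y n.+3 = tseq x y n.+2 * tseq x y n.+1.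
Proof. by []. Qed.

Lemma tseq_shift x y n : tseq (x * y) x n.+1 = tseq x y n.+2.
Proof.
suff: tseq (x * y) x n.+1 = tseq x y n.+2 /\ tseq (x * y) x n.+2 = tseq x y n.+3.
  by case.
by elim: n => [//|n [IH1 IH2]]; split=> //; rewrite !tseqSSS IH1 IH2.
Qed.

Lemma tseq_act x y z n : tseq (x * y) (x * z) n.+1 = x * tseq y z n.+1.
Proof.
suff: tseq (x * y) (x * z) n.+1 = x * tseq y z n.+1 /\
      tseq (x * y) (x * z) n.+2 = x * tseq y z n.+2 by case.
by elim: n => [//|n [IH1 IH2]]; split=> //; rewrite !tseqSSS IH1 IH2 -ldopD.
Qed.

(** By left distributivity, the composite of the left translations by t_{n+1} and t_n does not
    depend on n. When t_n = e, it is the translation by t_{n+1} alone. *)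
Lemma tseq_act_comp x y z n :
  tseq x y n.+2 * (tseq x y n.+1 * z) = x * (y * z).
Proof. by elim: n => [//|n IH]; rewrite tseqSSS -ldopD. Qed.

End FibonacciSequence.

Section Circ.
Variables (X : ldSystemType) (e : X).
Hypotheses (act1 : forall x : X, x * e = e) (one_act : forall x : X, e * x = x).
Implicit Types x y z c : X.

(** The graph of the operation to be constructed. The index [n.+1] avoids the junk value of [tseq]
    at 0. *)
Definition circ_rel x y c := exists n, tseq x y n.+1 = e /\ tseq x y n.+2 = c.

Lemma circ_rel_shift x y c : circ_rel (x * y) x c -> circ_rel x y c.
Proof. by case=> n; rewrite !tseq_shift => -[tn tSn]; exists n.+1. Qed.

Lemma circ_rel_right1 x : circ_rel x e x.
Proof. by exists 0. Qed.

Lemma circ_rel_act x y z c : circ_rel y z c -> circ_rel (x * y) (x * z) (x * c).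
Proof.
by case=> n [tn tSn]; exists n; rewrite !tseq_act tn tSn act1.
Qed.

Lemma circ_rel_act_comp x y z c : circ_rel x y c -> c * z = x * (y * z).
Proof. by case=> n [tn <-]; rewrite -(tseq_act_comp _ x y z n) tn one_act. Qed.

Lemma tseq_stable x y n k : tseq x y n.+1 = e ->
  tseq x y (n + k).+1 = (if odd k then tseq x y n.+2 else e).
Proof.
move=> tn; suff [] : tseq x y (n + k).+1 = (if odd k then tseq x y n.+2 else e)
  /\ tseq x y (n + k).+2 = (if odd k then e else tseq x y n.+2) by [].
elim: k => [|k [IH1 IH2]]; first by rewrite addn0.
rewrite addnS tseqSSS IH1 IH2 /=.
by case: (odd k) => /=; rewrite ?act1 ?one_act.
Qed.

Lemma circ_rel_fun x y c d : circ_rel x y c -> circ_rel x y d -> c = d.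
Proof.
case=> n [tn <-] [m [tm <-]].
wlog le_nm : n m tn tm / n <= m.
  by move=> W; case/orP: (leq_total n m) => /W -> //.
(* If m - n is even, the sequence has the same value after both occurrences of e. If it is odd, both
   values are e. *)
have := tseq_stable x y n (m - n) tn; have := tseq_stable x y n (m - n).+1 tn.
by rewrite addnS subnKC // oddS tm => ->; case: (odd _).
Qed.

Section Operation.
Variable circ : X -> X -> X.
Hypotheses (circ_shift : forall x y, circ (x * y) x = circ x y).
Hypotheses (circ_right1 : forall x, circ x e = x).

Lemma circ_tseq x y n : circ (tseq x y n.+2) (tseq x y n.+1) = circ x y.
Proof. by elim: n => [//|n <-]; rewrite tseqSSS circ_shift. Qed.

Lemma circ_rel_circ x y c : circ_rel x y c -> circ x y = c.
Proof. by case=> n [tn <-]; rewrite -(circ_tseq x y n) tn circ_right1. Qed.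

End Operation.

(** * Three-strand braids and associativity *)

(** [false] stands for sigma_1 and [true] for sigma_2, so that [~~ b] is the other generator. *)
Definition hurwitz3 (b : bool) (v : X * X * X) : X * X * X :=
  let: (x, y, z) := v in if b then (x, y * z, y) else (x * y, x, z).

Definition half_twist (v : X * X * X) : X * X * X :=
  let: (x, y, z) := v in (x * (y * z), x * y, x).

Definition concentrated c (v : X * X * X) : Prop :=
  [\/ v = (c, e, e), v = (e, c, e) | v = (e, e, c)].

Lemma half_twistE b v :
  half_twist v = hurwitz3 b (hurwitz3 (~~ b) (hurwitz3 b v)).
Proof. by case: v b => [[x y] z] [] //=; rewrite -ldopD. Qed.

(** Conjugation by the Garside element of the three-strand braid monoid exchanges its two
    generators. *)
Lemma half_twist_hurwitz3 b v :
  half_twist (hurwitz3 b v) = hurwitz3 (~~ b) (half_twist v).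
Proof. by case: v b => [[x y] z] [] /=; rewrite -!ldopD. Qed.

Lemma iter_half_twist_hurwitz3 m b v :
  iter m half_twist (hurwitz3 b v) = hurwitz3 (b (+) odd m) (iter m half_twist v).
Proof.
elim: m => [|m IH]; first by rewrite addbF.
by rewrite !iterS IH half_twist_hurwitz3 /= addbN.
Qed.

Lemma concentrated_hurwitz3 b c v :
  concentrated c v -> concentrated c (hurwitz3 b v).
Proof.
case=> ->; case: b; rewrite /= ?act1 ?one_act;
  by [constructor 1 | constructor 2 | constructor 3].
Qed.

Lemma concentrated_iter m c v :
  concentrated c v -> concentrated c (iter m half_twist v).
Proof.
move=> cv; elim: m => [//|m IH]; rewrite iterS (half_twistE true).
by do 3!apply: concentrated_hurwitz3.
Qed.

Lemma concentrated_inj c d v : concentrated c v -> concentrated d v -> c = d.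
Proof. by case=> ->; case; congruence. Qed.

(** Only powers of the half twist are allowed, so two witnesses m and k can be compared after m + k
    half twists. *)
Definition twists_to v c := exists m, concentrated c (iter m half_twist v).

Lemma twists_to_inj v c d : twists_to v c -> twists_to v d -> c = d.
Proof.
case=> m cm [k dk].
have := concentrated_iter k _ _ cm; have := concentrated_iter m _ _ dk.
by rewrite -!iterD addnC => cd /concentrated_inj; apply.
Qed.

(* [half_twistE] completes the generator to a half twist, at the cost of one
   more iteration. *)
Lemma twists_to_hurwitz3 b v c : twists_to (hurwitz3 b v) c -> twists_to v c.
Proof.
case=> m; rewrite iter_half_twist_hurwitz3 => cm; exists m.+1.
rewrite iterS (half_twistE (b (+) odd m)).
by do 2!apply: concentrated_hurwitz3.
Qed.

Lemma twists_to_iter k b v c : twists_to (iter k (hurwitz3 b) v) c -> twists_to v c.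
Proof. by elim: k => [//|k IH]; rewrite iterS => /twists_to_hurwitz3. Qed.

Lemma twists_to_circ_left x y z c d :
  circ_rel x y c -> twists_to (c, e, z) d -> twists_to (x, y, z) d.
Proof.
case=> n [tn tSn] cd; apply: (twists_to_iter n false).
suff -> : iter n (hurwitz3 false) (x, y, z) = (tseq x y n.+2, tseq x y n.+1, z).
  by rewrite tn tSn.
by elim: n {tn tSn} => [//|n IH]; rewrite iterS IH.
Qed.

Lemma twists_to_circ_right x y z c d :
  circ_rel y z c -> twists_to (x, c, e) d -> twists_to (x, y, z) d.
Proof.
case=> n [tn tSn] cd; apply: (twists_to_iter n true).
suff -> : iter n (hurwitz3 true) (x, y, z) = (x, tseq y z n.+2, tseq y z n.+1).
  by rewrite tn tSn.
by elim: n {tn tSn} => [//|n IH]; rewrite iterS IH.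
Qed.

Lemma twists_to1 c : twists_to (c, e, e) c.
Proof. by exists 0; constructor 1. Qed.

Lemma circ_rel_assoc x y z xy yz c d :
  circ_rel x y xy -> circ_rel xy z c -> circ_rel y z yz -> circ_rel x yz d ->
  d = c.
Proof.
(* The two routes are (x, y, z), (x, yz, e), (d, e, e) and (x, y, z), (xy, e, z), (xy, z, e), (c, e,
   e); sigma_2 moves e past z in the second. *)
move=> Rxy Rc Ryz Rd; apply: (twists_to_inj (x, y, z)).
  apply: (twists_to_circ_right _ _ _ _ _ Ryz).
  exact: (twists_to_circ_left _ _ _ _ _ Rd) (twists_to1 d).
apply: (twists_to_circ_left _ _ _ _ _ Rxy); apply: (twists_to_hurwitz3 true).
rewrite /= one_act.
exact: (twists_to_circ_left _ _ _ _ _ Rc) (twists_to1 c).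
Qed.

Lemma circ_LDMonoid (circ : X -> X -> X) :
    (forall x y, exists c, circ_rel x y c) ->
    (forall x y, circ (x * y) x = circ x y) -> (forall x, circ x e = x) ->
  is_LDMonoid circ e.
Proof.
move=> ex_circ circ_shift circ_right1.
have circP x y : circ_rel x y (circ x y).
  have [c Rc] := ex_circ x y.
  by rewrite (circ_rel_circ _ circ_shift circ_right1 _ _ _ Rc).
split=> //.
- by move=> x y z; apply: circ_rel_assoc.
- by move=> x; rewrite -circ_shift one_act.
- by move=> x y z; apply: circ_rel_act_comp.
- move=> x y z; apply/esym.
  by apply: (circ_rel_circ _ circ_shift circ_right1); apply: circ_rel_act.
Qed.

End Circ.

(** * Invariance of the product under braids *)

Section HurwitzProduct.
Variables (X : ldSystemType) (circ : X -> X -> X) (e : X).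
Hypothesis circ_monoid : is_LDMonoid circ e.

HB.instance Definition _ := Monoid.isLaw.Build X e circ
  (ldm_circA circ_monoid) (ldm_1circ circ_monoid) (ldm_circ1 circ_monoid).

Lemma big_hurwitz_gen n (x : n.-tuple X) (k : 'I_n.-1) :
  \big[circ/e]_(i < n) tnth (hurwitz_gen x k) i = \big[circ/e]_(i < n) tnth x i.
Proof.
have bigE (t : n.-tuple X) :
    \big[circ/e]_(i < n) tnth t i = \big[circ/e]_(0 <= i < n) nth e t i.
  by rewrite big_mkord; apply: eq_bigr => i _; rewrite (tnth_nth e).
have ltSkn := strandS_proof k; have ltkn := ltnW ltSkn.
have genE i : i < n -> nth e (hurwitz_gen x k) i =
    if i == k then nth e x k * nth e x k.+1
    else if i == k.+1 then nth e x k else nth e x i.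
  move=> ltin; rewrite -(tnth_nth e _ (Ordinal ltin)) tnth_mktuple.
  by rewrite -!val_eqE /= !(tnth_nth e).
move: (hurwitz_gen x k) genE => y genE.
rewrite !bigE !(big_cat_nat (leq0n k) (ltnW ltkn)) !(big_ltn ltkn) !(big_ltn ltSkn).
rewrite !genE ?eqxx ?(gtn_eqF (ltnSn k)) //=.
(* Reassociating isolates the two factors changed by the generator; the law x ∘ y = (x * y) ∘ x then
   applies to them. *)
rewrite !(ldm_circA circ_monoid) -!(ldm_circA circ_monoid _ _ (nth e x k)).
rewrite -(ldm_circ_comm circ_monoid) !(ldm_circA circ_monoid).
congr (circ (circ (circ _ _) _) _); apply: eq_big_nat => i /andP[lti ltj].
  by rewrite genE ?(ltn_trans ltj) // !ltn_eqF // ltnW.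
by rewrite genE // !gtn_eqF // ltnW.
Qed.

Lemma big_hurwitz n (x : n.-tuple X) (s : braid n) :
  \big[circ/e]_(i < n) tnth (hurwitz x s) i = \big[circ/e]_(i < n) tnth x i.
Proof.
rewrite /hurwitz /hurwitz_word; elim: (repr s) x => [//|k u IH] x /=.
by rewrite IH big_hurwitz_gen.
Qed.

Lemma big_all1_but n (y : n.-tuple X) (j : 'I_n) :
    (forall i : 'I_n, i <> j -> tnth y i = e) ->
  \big[circ/e]_(i < n) tnth y i = tnth y j.
Proof.
move=> y1; rewrite (big_only1 j) //.
by move=> i /eqP /y1.
Qed.

End HurwitzProduct.

Theorem theorem2p30 (X : ldSystemType) (e : X)
    (permX : permutative X) (Li_e : unique (@Li X) e) :
  (exists! circ : X -> X -> X,
     forall x y : X, circ (x * y) x = circ x y /\ x = circ x e) /\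
  (forall circ : X -> X -> X,
     (forall x y : X, circ (x * y) x = circ x y /\ x = circ x e) ->
     is_LDMonoid circ e /\
     (forall (n : nat) (x y : n.-tuple X) (s : braid n) (j : 'I_n),
        hurwitz x s = y ->
        (forall i : 'I_n, i <> j -> tnth y i = e) ->
        tnth y j = \big[circ/e]_(i < n) tnth x i)).
Proof.
case: permX Li_e => Li_ideal ex_Li [one_act e_uniq].
(* The left ideal property makes x * e a left-identity, hence equal to e. *)
have act1 x : x * e = e by apply/esym/e_uniq/Li_ideal.
have ex_circ x y : exists c, circ_rel _ e x y c.
  have [[|n] [// _ /e_uniq tn]] := ex_Li x y.
  by exists (tseq x y n.+2), n.
have circ_relE (circ : X -> X -> X) :
    (forall x y, circ (x * y) x = circ x y /\ x = circ x e) ->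
    forall x y c, circ_rel _ e x y c -> circ x y = c.
  move=> circP x y c; apply: circ_rel_circ => [a b|a].
    by case: (circP a b).
  by case: (circP a e).
split.
  (* Choice turns the total relation [circ_rel] into an operation. *)
  have [circ circP] : exists circ : X -> X -> X,
      forall x y, circ_rel _ e x y (circ x y).
    by exists (fun x y => sval (cid (ex_circ x y))) => x y; exact: svalP.
  exists circ; split=> [x y|circ' circP'].
    split; apply: (circ_rel_fun _ e act1 one_act) (circP _ _).
      by apply: circ_rel_shift; apply: circP.
    exact: circ_rel_right1.
  by apply/funext=> x; apply/funext=> y; rewrite (circ_relE _ circP' x y _ (circP x y)).
move=> circ circP.
have circ_monoid : is_LDMonoid circ e.
  by apply: circ_LDMonoid => // [x y|x]; [case: (circP x y) | case: (circP x e)].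
split=> // n x y s j <- y1.
by rewrite -(big_hurwitz _ _ _ circ_monoid _ x s) (big_all1_but _ _ _ circ_monoid _ _ _ y1).
Qed.
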